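(* Assume prior identifiability: for every $\pi\in\Lambda$, for $m^\pi$-almost every $x\in\mathcal{X}$ the map $a\mapsto \Pi_x^a$ is injective on $\Lambda$. Then for every prior $\pi\in\Lambda$ and every strictly proper scoring rule $S$, Bayes rules under $\pi$ for the prior disclosure game with score $S$ select $\pi$ almost surely, i.e. every Bayes rule $\delta^\star$ under $\pi$ satisfies $\delta^\star(x)=\pi$ for $m^\pi$-almost every $x$, and the minimum Bayes risk equals $$r_S(\pi)=\mathbb{E}_{X\sim m^\pi}\big[H_S(\Pi_X^\pi)\big].$$
   Context: Setting. $(\Omega,\mathcal{T})$ is a standard Borel parameter space; $\{P_\theta:\theta\in\Omega\}$ is a family of probability measures on a measurable space $(\mathcal{X},\mathcal{A})$ dominated by a $\sigma$-finite measure $\lambda$, with densities $p_\theta=dP_\theta/d\lambda$. $\Lambda$ is a set of probability measures on $(\Omega,\mathcal{T})$ (priors), with the weak topology and its Borel $\sigma$-algebra. For a prior $\pi$, the prior predictive $m^\pi$ is the measure on $\mathcal{X}$ with $\frac{dm^\pi}{d\lambda}(x)=\int_\Omega p_\theta(x)\,d\pi(\theta)$, and $\Pi_x^\pi$ is the Bayes posterior on $\Omega$ given $X=x$, assumed to exist for $m^\pi$-almost all $x$ and to be measurable in $x$. Scores. A scoring rule $S$ assigns to each probability measure $Q$ on $(\Omega,\mathcal{T})$ a measurable function $S(Q,\cdot):\Omega\to\mathbb{R}\cup\{-\infty\}$. It is proper if $\mathbb{E}_{Y\sim P}[S(P,Y)]\ge\mathbb{E}_{Y\sim P}[S(Q,Y)]$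 for all $P,Q$, and strictly proper if in addition equality implies $Q=P$. Its generalized entropy is $H_S(P)=-\mathbb{E}_{Y\sim P}[S(P,Y)]$. Prior disclosure game. A decision rule is a measurable map $\delta:\mathcal{X}\to\Lambda$. The loss is $\ell_S(\theta,x,a)=-S(\Pi_x^a,\theta)$ for $a\in\Lambda$. The frequentist risk is $\mathcal{R}_S(\delta,\theta)=\mathbb{E}_{X\sim P_\theta}[\ell_S(\theta,X,\delta(X))]$. The Bayes risk under $\pi\in\Lambda$ is $$R_S(\delta,\pi)=\mathbb{E}_{\Theta\sim\pi}[\mathcal{R}_S(\delta,\Theta)]=-\mathbb{E}_{X\sim m^\pi}\Big[\mathbb{E}_{\Theta\sim\Pi_X^\pi}\big[S(\Pi_X^{\delta(X)},\Theta)\big]\Big].$$ The minimum Bayes risk is $r_S(\pi)=\inf_\delta R_S(\delta,\pi)$ over all decision rules, and $\delta$ is a Bayes rule under $\pi$ if $R_S(\delta,\pi)=r_S(\pi)$. Conventions. The posteriors $\Pi_x^a$ appearing in these definitions and in the identifiability condition are assumed to exist; risks and the expectations defining them are measurable, well defined and finite. *)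

(* Defs.v *)
From HB Require Import structures.
From mathcomp Require Import all_boot all_order all_algebra.
From mathcomp Require Import all_classical all_reals all_analysis.
From mathcomp Require Import measurable_realfun giry.

Set Implicit Arguments.
Unset Strict Implicit.
Unset Printing Implicit Defensive.

Import Order.TTheory GRing.Theory Num.Theory.
Import numFieldNormedType.Exports.

Local Open Scope classical_set_scope.
Local Open Scope ring_scope.
Local Open Scope ereal_scope.

Definition complete_metric_for (R : realType) (T : topologicalType)
    (dist : T -> T -> R) : Prop :=
  [/\ (forall x y, (0 <= dist x y)%R),
      (forall x y, dist x y = 0%R <-> x = y),
      (forall x y, dist x y = dist y x),
      (forall x y z, (dist x z <= dist x y + dist y z)%R) &
      (forall x (A : set T), nbhs x A <->
         exists2 e : R, (0 < e)%R & [set y | (dist x y < e)%R] `<=` A) /\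
      (forall u : nat -> T,
         (forall e : R, (0 < e)%R -> exists N : nat, forall m n : nat,
            (N <= m)%N -> (N <= n)%N -> (dist (u m) (u n) < e)%R) ->
         exists l : T, u @ \oo --> l)].

Definition polish (R : realType) (T : topologicalType) : Prop :=
  (exists2 D : set T, countable D & dense D) /\
  (exists dist : T -> T -> R, complete_metric_for dist).

Notation borel T := (g_sigma_algebraType (@open T)).

Section weak_topology_of_probabilities.
Context (R : realType) (T : ptopologicalType).

Definition bounded_continuous : Type :=
  {f : T -> R | continuous f /\ exists M : R, forall x, (`|f x| <= M)%R}.

Definition integrate_against (f : bounded_continuous)
    (P : probability (borel T) R) : R :=
  Rintegral P setT (sval f : borel T -> R).

(* Probability measures on the Borel sets of T, with the coarsest topology
   making P |-> \int f dP continuous for all bounded continuous f. *)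
Definition weak_probability : Type :=
  @sup_topology (probability (borel T) R) bounded_continuous
    (fun f => Topological.class (initial_topology (integrate_against f))).

HB.instance Definition _ := Topological.on weak_probability.

End weak_topology_of_probabilities.

Arguments weak_probability R T : clear implicits.

Section scoring_rules.
Context d (Omega : measurableType d) (R : realType).
Implicit Types (S : probability Omega R -> Omega -> \bar R)
  (P Q : probability Omega R).

Definition scoring_rule S : Prop :=
  forall Q, measurable_fun [set: Omega] (S Q) /\ (forall y, S Q y < +oo).

Definition expected_score S P Q : \bar R := \int[P]_y S Q y.

(* The expectation is not of the form +oo - oo, a case for which the library's
   integral would return a conventional value. *)
Definition expected_score_exists S P Q : Prop :=
  \int[P]_y (S Q)^\+ y < +oo \/ \int[P]_y (S Q)^\- y < +oo.

Definition proper S : Prop :=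
  forall P Q, expected_score_exists S P Q /\
    expected_score S P Q <= expected_score S P P.

(* Measures are compared by ≡μ, i.e. on measurable sets: a [probability] is a
   function on all sets, so Leibniz equality would be too fine. *)
Definition strictly_proper S : Prop :=
  [/\ scoring_rule S, proper S &
      forall P Q, expected_score S P Q = expected_score S P P -> Q ≡μ P].

Definition entropy S P : \bar R := - expected_score S P P.

End scoring_rules.

Record dominated_model (R : realType) d (Omega : measurableType d)
    d' (X : measurableType d') := DominatedModel {
  law : Omega -> probability X R ;
  dominating : {sigma_finite_measure set X -> \bar R} ;
  density : Omega -> X -> R ;
  density_ge0 : forall t x, (0 <= density t x)%R ;
  measurable_density :
    measurable_fun [set: Omega * X] (fun tx => density tx.1 tx.2) ;
  lawE : forall t A, measurable A ->
    law t A = \int[dominating]_(x in A) (density t x)%:E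
}.

Section prior_predictive.
Context (R : realType) d (Omega : measurableType d) d' (X : measurableType d').
Variables (M : dominated_model R Omega X) (pi : probability Omega R).

Definition marginal_density (x : X) : \bar R :=
  \int[pi]_t (density M t x)%:E.

Lemma marginal_density_ge0 x : 0 <= marginal_density x.
Proof. by apply: integral_ge0 => t _; rewrite lee_fin density_ge0. Qed.

Lemma measurable_marginal_density : measurable_fun [set: X] marginal_density.
Proof.
apply: (@measurable_fun_fubini_tonelli_G _ _ _ _ _ pi
  (fun tx : Omega * X => (density M tx.1 tx.2)%:E)).
- by apply/measurable_EFinP; exact: measurable_density.
- by move=> tx; rewrite lee_fin density_ge0.
Qed.

Definition prior_predictive (A : set X) : \bar R :=
  \int[dominating M]_(x in A) marginal_density x.

Let prior_predictive0 : prior_predictive set0 = 0.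
Proof. exact: integral_set0. Qed.

Let prior_predictive_ge0 A : 0 <= prior_predictive A.
Proof. by apply: integral_ge0 => x _; exact: marginal_density_ge0. Qed.

Let prior_predictive_sigma_additive : semi_sigma_additive prior_predictive.
Proof.
move=> F mF tF mUF; rewrite /prior_predictive ge0_integral_bigcup//.
- apply: is_cvg_ereal_nneg_natsum_cond => n _ _.
  by apply: integral_ge0 => x _; exact: marginal_density_ge0.
- exact: measurable_funTS measurable_marginal_density.
- by move=> x _; exact: marginal_density_ge0.
Qed.

HB.instance Definition _ := isMeasure.Build _ _ _ prior_predictive
  prior_predictive0 prior_predictive_ge0 prior_predictive_sigma_additive.

(* A version of the posterior: Bayes's formula
   Pi_x(B) = (\int_B p_t(x) dpi(t)) / (\int p_t(x) dpi(t)), cleared of its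
   denominator, which lies in ]0, +oo[ for almost every x. *)
Definition posterior (Pi : X -> probability Omega R) : Prop :=
  (forall B, measurable B -> measurable_fun [set: X] (fun x => Pi x B)) /\
  {ae prior_predictive, forall x, forall B, measurable B ->
     Pi x B * marginal_density x = \int[pi]_(t in B) (density M t x)%:E}.

End prior_predictive.

Section prior_disclosure_game.
Context (R : realType) (T : ptopologicalType) d (X : measurableType d).
Variables (M : dominated_model R (borel T) X)
  (Lambda : set (weak_probability R T))
  (Pi : Lambda -> X -> probability (borel T) R).
Implicit Types (S : probability (borel T) R -> borel T -> \bar R)
  (a b pi : Lambda) (delta : X -> Lambda).

Definition prior (a : Lambda) : probability (borel T) R := set_val a.

Definition prior_identifiable : Prop :=
  forall pi, {ae prior_predictive M (prior pi), forall x,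
    forall a b, Pi a x ≡μ Pi b x -> prior a ≡μ prior b}.

Definition decision_rule delta : Prop :=
  forall B : set Lambda, <<s @open Lambda >> B -> measurable (delta @^-1` B).

Definition loss S (t : borel T) (x : X) a : \bar R := - S (Pi a x) t.

Definition risk S delta (t : borel T) : \bar R :=
  \int[law M t]_x loss S t x (delta x).

Definition bayes_risk S delta pi : \bar R := \int[prior pi]_t risk S delta t.

Definition min_bayes_risk S pi : \bar R :=
  ereal_inf [set bayes_risk S delta pi | delta in decision_rule].

Definition bayes_rule S pi delta : Prop :=
  decision_rule delta /\ bayes_risk S delta pi = min_bayes_risk S pi.

(* The loss of every decision rule is integrable under each P_t and under the
   joint law P_t(dx) pi(dt), so that its iterated expectations are finite and
   the order of integration does not matter. *)
Definition finite_risks S pi : Prop :=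
  forall delta, decision_rule delta ->
  [/\ measurable_fun [set: borel T * X]
        (fun tx => loss S tx.1 tx.2 (delta tx.2)),
      (forall t, (law M t).-integrable [set: X]
         (fun x => loss S t x (delta x))) &
      \int[prior pi]_t \int[law M t]_x `|loss S t x (delta x)| < +oo].

End prior_disclosure_game.

(* Main.v *)
Require Import Defs.
From HB Require Import structures.
From mathcomp Require Import all_boot all_order all_algebra.
From mathcomp Require Import all_classical all_reals all_analysis.
From mathcomp Require Import measurable_realfun giry.

Set Implicit Arguments.
Unset Strict Implicit.
Unset Printing Implicit Defensive.

Import Order.TTheory GRing.Theory Num.Theory.
Import numFieldNormedType.Exports.

Local Open Scope classical_set_scope.
Local Open Scope ring_scope.
Local Open Scope ereal_scope.

(** The joint law of the parameter and the observation can be disintegrated in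
    two ways: draw t from the prior pi and then x from P_t, or draw x from the
    prior predictive and then t from the posterior Pi_x. Integrating the loss of
    a decision rule delta in the first order gives its Bayes risk; in the second
    order ([integral_disintegration]) it gives
      R(delta, pi) = E_x [ - E_(t ~ Pi_x) S(Pi_x^(delta x), t) ].
    Since S is proper, for each x the quantity in brackets is smallest when the
    posterior reported by delta is Pi_x itself, which the constant rule pi
    achieves. The constant rule is therefore optimal and its risk is the expected
    entropy of the posterior ([min_bayes_riskE]).

    If delta is another Bayes rule, its pointwise expected loss dominates that of
    the constant rule while the two finite integrals agree, so the two are equal
    for almost every x ([bayes_rule_ae_expected_score]). Strict propriety turns
    the equality of scores into the equality of the posteriors of x under the
    priors delta x and pi, and identifiability into that of the priors.

    The disintegration rests on Tonelli's theorem for the product of the prior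
    and the dominating measure, and on Bayes's formula for the integral of a
    nonnegative function against the posterior ([posterior_integral]). *)

(** * Integration against a measure with a density *)

Section density.
Context d (T : measurableType d) (R : realType).
Variables (mu nu : {measure set T -> \bar R}) (p : T -> R).
Hypotheses (p0 : forall x, (0 <= p x)%R) (mp : measurable_fun [set: T] p).
Hypothesis nuE : forall A, measurable A -> nu A = \int[mu]_(x in A) (p x)%:E.

Import HBNNSimple.

Let integral_density_nnsfun (f : {nnsfun T >-> R}) :
  \int[nu]_x (f x)%:E = \int[mu]_x ((p x)%:E * (f x)%:E).
Proof.
have mpE : measurable_fun [set: T] (EFin \o p) by exact/measurable_EFinP.
(* Writing f as the sum over its values r of r times the indicator of the
   level set reduces both sides to the hypothesis on nu. *)
under [LHS]eq_integral do rewrite fimfunE -fsumEFin//.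
rewrite ge0_integral_fsum//; last 2 first.
- by move=> r; exact/measurable_EFinP/measurableT_comp.
- by move=> r x _; rewrite EFinM nnfun_muleindic_ge0.
under [RHS]eq_integral => x _.
  rewrite fimfunE -fsumEFin// ge0_mule_fsumr; last first.
    by move=> r; rewrite EFinM nnfun_muleindic_ge0.
  over.
rewrite [RHS]ge0_integral_fsum//; last 2 first.
- move=> r; apply: emeasurable_funM => //.
  exact/measurable_EFinP/measurableT_comp.
- by move=> r x _; rewrite mule_ge0 ?lee_fin// -lee_fin EFinM nnfun_muleindic_ge0.
apply: eq_fsbigr => r /[!inE] -[x _ fxr].
have r0 : 0 <= r%:E by rewrite lee_fin -fxr.
rewrite integralZl_indic_nnsfun// integral_indic// setIT nuE//.
rewrite -ge0_integralZl//=; last 2 first.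
- exact: measurable_funTS.
- by move=> y _; rewrite lee_fin.
rewrite integral_mkcond; apply: eq_integral => y _.
rewrite patchE indicE; case: ifPn => _; last by rewrite mulr0 mule0.
by rewrite mulr1 muleC.
Qed.

(** Simple functions follow by linearity, the general case by monotone
    convergence along simple functions. The density takes finite values so
    that multiplication by it commutes with this limit. *)
Lemma ge0_integral_density (f : T -> \bar R) :
    measurable_fun [set: T] f -> (forall x, 0 <= f x) ->
  \int[nu]_x f x = \int[mu]_x ((p x)%:E * f x).
Proof.
move=> mf f0; pose f_ := nnsfun_approx measurableT mf.
have mpE : measurable_fun [set: T] (EFin \o p) by exact/measurable_EFinP.
have f_f x : (f_ n x)%:E @[n --> \oo] --> f x by exact: cvg_nnsfun_approx.
transitivity (limn (fun n => \int[nu]_x (f_ n x)%:E)).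
  rewrite -monotone_convergence//=.
  - by apply: eq_integral => x _; apply/esym/cvg_lim.
  - by move=> n; exact/measurable_EFinP.
  - by move=> n x _; rewrite lee_fin.
  - by move=> x _ a b ab; rewrite lee_fin; exact/lefP/nd_nnsfun_approx.
under eq_fun do rewrite integral_density_nnsfun.
rewrite -monotone_convergence//=.
- apply: eq_integral => x _; apply/cvg_lim => //.
  exact: cvgeZl.
- by move=> n; apply: emeasurable_funM => //; exact/measurable_EFinP.
- by move=> n x _; rewrite mule_ge0 ?lee_fin.
- move=> x _ a b ab; rewrite lee_wpmul2l ?lee_fin//.
  exact/lefP/nd_nnsfun_approx.
Qed.

End density.

(** * Disintegration of the joint law of parameter and observation *)

Section disintegration.
Context (R : realType) d (Omega : measurableType d) d' (X : measurableType d').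
Variables (M : dominated_model R Omega X) (pi : probability Omega R).

Let mdensity :
  measurable_fun [set: Omega * X] (fun tx => (density M tx.1 tx.2)%:E).
Proof. by apply/measurable_EFinP; exact: measurable_density. Qed.

Lemma law_integral t (f : X -> \bar R) :
    measurable_fun [set: X] f -> (forall x, 0 <= f x) ->
  \int[law M t]_x f x = \int[dominating M]_x ((density M t x)%:E * f x).
Proof.
apply: ge0_integral_density => [x||]; first exact: density_ge0.
- exact: (measurableT_comp (@measurable_density _ _ _ _ _ M)
    (measurable_pair1 t)).
- exact: lawE.
Qed.

Lemma measurable_law_integral (h : Omega * X -> \bar R) :
    measurable_fun [set: Omega * X] h -> (forall tx, 0 <= h tx) ->
  measurable_fun [set: Omega] (fun t => \int[law M t]_x h (t, x)).
Proof.
move=> mh h0.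
rewrite (_ : (fun t => _) = (fun t =>
    \int[dominating M]_x ((density M t x)%:E * h (t, x)))); last first.
  apply/funext => t; apply: law_integral => //.
  exact: (measurableT_comp mh (measurable_pair1 t)).
apply: (measurable_fun_fubini_tonelli_F
  (fun tx => (density M tx.1 tx.2)%:E * h tx)).
  exact: emeasurable_funM.
by move=> tx; rewrite mule_ge0// lee_fin density_ge0.
Qed.

Lemma integral_marginal_density :
  \int[dominating M]_x marginal_density M pi x = 1.
Proof.
rewrite /marginal_density -(fubini_tonelli _ mdensity)/=; last first.
  by move=> tx; rewrite lee_fin density_ge0.
under eq_integral do rewrite -lawE// probability_setT.
rewrite integral_cst// mul1e; exact: probability_setT.
Qed.

Lemma marginal_density_ae_fin_num :
  {ae dominating M, forall x, marginal_density M pi x \is a fin_num}.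
Proof.
have : (dominating M).-integrable [set: X] (marginal_density M pi).
  apply/integrableP; split; first exact: measurable_marginal_density.
  under eq_integral do rewrite gee0_abs ?marginal_density_ge0//.
  by rewrite integral_marginal_density ltry.
by move=> /(integrable_ae measurableT); apply: filterS => x xfin; exact: xfin.
Qed.

Let mfine : measurable_fun [set: X] (fine \o marginal_density M pi).
Proof.
by apply: measurableT_comp => //; exact: measurable_marginal_density.
Qed.

Let fine_ge0 x : (0 <= fine (marginal_density M pi x))%R.
Proof. by rewrite fine_ge0// marginal_density_ge0. Qed.

(** The marginal density may be infinite on a null set; [fine] sends it to 0
    there, and this provides the real-valued density that
    [ge0_integral_density] asks for. *)
Let prior_predictiveE A : measurable A ->
  prior_predictive M pi A =
  \int[dominating M]_(x in A) (fine (marginal_density M pi x))%:E.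
Proof.
move=> mA; apply: ge0_ae_eq_integral => //.
- exact: measurable_funTS (measurable_marginal_density _ _).
- by apply/measurable_EFinP; exact: measurable_funTS.
- by move=> x _; exact: marginal_density_ge0.
- by move=> x _; rewrite lee_fin.
- by apply: filterS marginal_density_ae_fin_num => x xfin _; rewrite fineK.
Qed.

(** A set that is null for the prior predictive is null for [dominating M] up to
    the points where the marginal density vanishes, because the integral of that
    density over it is zero. *)
Lemma ae_prior_predictive (P : X -> Prop) :
  {ae prior_predictive M pi, forall x, P x} ->
  {ae dominating M, forall x, marginal_density M pi x != 0 -> P x}.
Proof.
move=> [N [mN N0 PN]].
have mN0 : ae_eq (dominating M) N (marginal_density M pi) (cst 0).
  apply/(ae_eq_integral_abs _ mN).
    exact: measurable_funTS (measurable_marginal_density _ _).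
  by under eq_integral do rewrite gee0_abs ?marginal_density_ge0//.
apply: filterS mN0 => x xN /eqP mx0; apply: contrapT => Px.
by apply/mx0/xN/PN.
Qed.

Variable Pi : X -> probability Omega R.
Hypothesis hPi : posterior M pi Pi.

Lemma measurable_posterior_integral (h : Omega * X -> \bar R) :
    measurable_fun [set: Omega * X] h -> (forall tx, 0 <= h tx) ->
  measurable_fun [set: X] (fun x => \int[Pi x]_t h (t, x)).
Proof.
move=> mh h0.
(* Measurability of x |-> Pi x B for every B is what makes Pi a kernel. *)
pose K : X -> {measure set Omega -> \bar R} := fun x => Pi x.
pose ker := isKernel.Build _ _ _ _ R K hPi.1.
pose kerK : R.-ker X ~> Omega := HB.pack K ker.
have K1 x : kerK x [set: Omega] = 1 by exact: probability_setT.
pose prob := Kernel_isProbability.Build _ _ _ _ R kerK K1.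
pose pkerK : R.-pker X ~> Omega := HB.pack K ker prob.
apply: (measurable_fun_integral_finite_kernel
  (fun xt : X * Omega => h (xt.2, xt.1)) pkerK) => //.
by apply: measurableT_comp mh _; exact: measurable_swap.
Qed.

(** Bayes's formula, passed from events to functions: the posterior scaled by
    the marginal density is the measure of density t |-> p_t(x) with respect to
    the prior. The formula holds almost everywhere for the dominating measure
    and not only for the prior predictive, since both sides vanish wherever the
    marginal density does. *)
Lemma posterior_integral :
  {ae dominating M, forall x, forall h : Omega -> \bar R,
     measurable_fun [set: Omega] h -> (forall t, 0 <= h t) ->
     \int[pi]_t ((density M t x)%:E * h t) =
     (fine (marginal_density M pi x))%:E * \int[Pi x]_t h t}.
Proof.
have := ae_prior_predictive hPi.2.
have := marginal_density_ae_fin_num; apply: filterS2 => x mfin bayes h mh h0.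
have mdx : measurable_fun [set: Omega] (fun t => density M t x).
  exact: (measurableT_comp (@measurable_density _ _ _ _ _ M)
    (measurable_pair2 x)).
pose k : {nonneg R} := NngNum (fine_ge0 x).
rewrite -(ge0_integral_mscale (Pi x) measurableT k mh)//.
symmetry; apply: ge0_integral_density => //.
  by move=> t; exact: density_ge0.
move=> B mB; rewrite /= /mscale/= fineK//.
have [m0|/bayes <- //] := eqVneq (marginal_density M pi x) 0; last first.
  by rewrite muleC.
(* Here the marginal density, an integral of t |-> p_t(x) over the whole
   parameter space, is zero, hence so is the integral over B. *)
rewrite m0 mul0e; apply/esym/eqP; rewrite eq_le; apply/andP; split.
  rewrite -m0; apply: ge0_subset_integral => //.
    exact/measurable_EFinP.
  by move=> t _; rewrite lee_fin density_ge0.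
by apply: integral_ge0 => t _; rewrite lee_fin density_ge0.
Qed.

(** Both iterated integrals equal the double integral of p_t(x) h(t, x) with
    respect to the prior and the dominating measure: the left one by the
    definition of the densities, the right one by Bayes's formula, and Tonelli's
    theorem exchanges the order. *)
Lemma ge0_integral_disintegration (h : Omega * X -> \bar R) :
    measurable_fun [set: Omega * X] h -> (forall tx, 0 <= h tx) ->
  \int[pi]_t \int[law M t]_x h (t, x) =
  \int[prior_predictive M pi]_x \int[Pi x]_t h (t, x).
Proof.
move=> mh h0.
have mph : measurable_fun [set: Omega * X]
    (fun tx => (density M tx.1 tx.2)%:E * h tx) by exact: emeasurable_funM.
have ph0 tx : 0 <= (density M tx.1 tx.2)%:E * h tx.
  by rewrite mule_ge0// lee_fin density_ge0.
have mG := measurable_posterior_integral mh h0.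
transitivity (\int[pi]_t \int[dominating M]_x ((density M t x)%:E * h (t, x))).
  apply: eq_integral => t _; apply: law_integral => //.
  exact: (measurableT_comp mh (measurable_pair1 t)).
rewrite (fubini_tonelli _ mph ph0)/=.
rewrite [RHS](ge0_integral_density fine_ge0 mfine prior_predictiveE)//; last first.
  by move=> x; exact: integral_ge0.
apply: ge0_ae_eq_integral => //.
- exact: (measurable_fun_fubini_tonelli_G _ mph ph0).
- by apply: emeasurable_funM => //; exact/measurable_EFinP.
- by move=> x _; apply: integral_ge0 => t _; exact: (ph0 (t, x)).
- by move=> x _; rewrite mule_ge0 ?lee_fin//; exact: integral_ge0.
- apply: filterS posterior_integral => x E _.
  by apply: E => //; exact: (measurableT_comp mh (measurable_pair2 x)).
Qed.

(** The positive and negative parts of f are treated separately, each having a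
    finite iterated integral. *)
Lemma integral_disintegration (f : Omega * X -> \bar R) :
    measurable_fun [set: Omega * X] f ->
    \int[pi]_t \int[law M t]_x `|f (t, x)| < +oo ->
  (prior_predictive M pi).-integrable [set: X]
    (fun x => \int[Pi x]_t f (t, x)) /\
  \int[pi]_t \int[law M t]_x f (t, x) =
  \int[prior_predictive M pi]_x \int[Pi x]_t f (t, x).
Proof.
move=> mf foo.
have part (h : Omega * X -> \bar R) : measurable_fun [set: Omega * X] h ->
    (forall tx, 0 <= h tx) -> (forall tx, h tx <= `|f tx|) ->
  [/\ pi.-integrable [set: Omega] (fun t => \int[law M t]_x h (t, x)),
      (prior_predictive M pi).-integrable [set: X]
        (fun x => \int[Pi x]_t h (t, x)) &
      \int[pi]_t \int[law M t]_x h (t, x) =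
      \int[prior_predictive M pi]_x \int[Pi x]_t h (t, x)].
  move=> mh h0 hf; have hE := ge0_integral_disintegration mh h0.
  have law_ge0 t : 0 <= \int[law M t]_x h (t, x) by exact: integral_ge0.
  have post_ge0 x : 0 <= \int[Pi x]_t h (t, x) by exact: integral_ge0.
  have hoo : \int[pi]_t \int[law M t]_x h (t, x) < +oo.
    apply: le_lt_trans foo; apply: ge0_le_integral => //.
    - exact: measurable_law_integral.
    - apply: (measurable_law_integral (h := abse \o f)).
        exact: measurableT_comp.
      by move=> tx; exact: abse_ge0.
    - move=> t _; apply: ge0_le_integral => //.
      + exact: (measurableT_comp mh (measurable_pair1 t)).
      + apply: measurableT_comp => //.
        exact: (measurableT_comp mf (measurable_pair1 t)).
  split=> //; apply/integrableP; split.
  - exact: measurable_law_integral.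
  - by under eq_integral do rewrite gee0_abs//.
  - exact: measurable_posterior_integral.
  - by under eq_integral do rewrite gee0_abs//; rewrite -hE.
have pos_le tx : f^\+ tx <= `|f tx|.
  by rewrite funeposE ge_max lee_abs abse_ge0.
have neg_le tx : f^\- tx <= `|f tx|.
  by rewrite funenegE ge_max -abseN lee_abs abse_ge0.
have [lp pp pE] := part _ (measurable_funepos mf) (funepos_ge0 f) pos_le.
have [ln pn nE] := part _ (measurable_funeneg mf) (funeneg_ge0 f) neg_le.
have postE : (fun x => \int[Pi x]_t f (t, x)) =
    (fun x => \int[Pi x]_t f^\+ (t, x)) \- (fun x => \int[Pi x]_t f^\- (t, x)).
  apply/funext => x; rewrite integralE; congr (_ - _);
    by apply: eq_integral => t _; rewrite ?funeposE ?funenegE.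
have riskE : (fun t => \int[law M t]_x f (t, x)) =
    (fun t => \int[law M t]_x f^\+ (t, x)) \-
    (fun t => \int[law M t]_x f^\- (t, x)).
  apply/funext => t; rewrite integralE; congr (_ - _);
    by apply: eq_integral => x _; rewrite ?funeposE ?funenegE.
split; first by rewrite postE; exact: integrableB.
by rewrite postE riskE (integralB _ lp ln)// (integralB _ pp pn)// pE nE.
Qed.

End disintegration.

(** * Optimality of disclosing the true prior *)

(** The difference f - g is nonnegative with zero integral; it is well defined
    almost everywhere because both functions are almost everywhere finite. *)
Lemma integral_le_eq_ae d (T : measurableType d) (R : realType)
    (mu : {measure set T -> \bar R}) (f g : T -> \bar R) :
    mu.-integrable [set: T] f -> mu.-integrable [set: T] g ->
    (forall x, g x <= f x) -> \int[mu]_x f x = \int[mu]_x g x ->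
  ae_eq mu [set: T] f g.
Proof.
move=> intf intg gf fg.
have fin : {ae mu, forall x, f x \is a fin_num /\ g x \is a fin_num}.
  have := integrable_ae measurableT intg.
  have := integrable_ae measurableT intf.
  by apply: filterS2 => x ffin gfin; split; [exact: ffin|exact: gfin].
have mfg : measurable_fun [set: T] (f \- g).
  by apply: emeasurable_funB; exact: (measurable_int mu).
have : ae_eq mu [set: T] (f \- g) (cst 0).
  apply/ae_eq_integral_abs => //.
  rewrite (ae_eq_integral (f \- g))//.
  - rewrite integralB// fg subee//; exact: integrable_fin_num.
  - exact: measurableT_comp.
  - apply: filterS fin => x [_ gfin] _ /=.
    by rewrite gee0_abs// suber_ge0.
have := fin; apply: filterS2 => x [ffin gfin] /(_ I) /eqP.
by rewrite sube_eq// add0e => /eqP.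
Qed.

Section game.
Context (R : realType) (T : ptopologicalType) d (X : measurableType d).
Variables (M : dominated_model R (borel T) X)
  (Lambda : set (weak_probability R T))
  (Pi : Lambda -> X -> probability (borel T) R).
Hypothesis hPi : forall a : Lambda, posterior M (prior a) (Pi a).
Variables (pi : Lambda) (S : probability (borel T) R -> borel T -> \bar R).
Hypothesis hS : Defs.proper S.
Hypothesis hfin : finite_risks M Pi S pi.

Lemma decision_rule_cst : decision_rule (fun _ : X => pi).
Proof. by move=> B _; rewrite preimage_cst; case: ifP. Qed.

(** The sign comes out of the integral because propriety excludes expected
    scores of the form +oo - oo. *)
Lemma posterior_expected_loss (delta : X -> Lambda) x :
  \int[Pi pi x]_t loss Pi S t x (delta x) =
  - expected_score S (Pi pi x) (Pi (delta x) x).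
Proof.
apply: integralN; have [] := (hS (Pi pi x) (Pi (delta x) x)).1.
- move=> poo; rewrite fin_num_adde_defr// ge0_fin_numE//.
  exact: integral_ge0.
- move=> noo; rewrite fin_num_adde_defl// fin_numN ge0_fin_numE//.
  exact: integral_ge0.
Qed.

(** The Bayes risk averages, over the prior predictive, the posterior expected
    loss, so it can be minimized for each observation separately. *)
Lemma bayes_risk_posterior (delta : X -> Lambda) : decision_rule delta ->
  (prior_predictive M (prior pi)).-integrable [set: X]
    (fun x => - expected_score S (Pi pi x) (Pi (delta x) x)) /\
  bayes_risk M Pi S delta pi =
  \int[prior_predictive M (prior pi)]_x
    - expected_score S (Pi pi x) (Pi (delta x) x).
Proof.
move=> /hfin[mloss _ loss_lty].
have := integral_disintegration (hPi pi) mloss loss_lty.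
by under eq_fun do rewrite posterior_expected_loss.
Qed.

(** By propriety the constant rule pi minimizes the posterior expected loss at
    every observation, so it attains the infimum. *)
Lemma min_bayes_riskE :
  min_bayes_risk M Pi S pi =
  \int[prior_predictive M (prior pi)]_x entropy S (Pi pi x).
Proof.
have [intpi riskpi] := bayes_risk_posterior decision_rule_cst.
apply/eqP; rewrite eq_le; apply/andP; split.
  rewrite -riskpi; apply: ereal_inf_lbound.
  by exists (fun _ => pi) => //; exact: decision_rule_cst.
apply: le_ereal_inf_tmp => _ [delta /bayes_risk_posterior[intd ->] <-].
apply: le_integral => // x _.
by rewrite leeN2; exact: (hS _ _).2.
Qed.

(** A Bayes rule has the same total risk as the constant rule pi although its
    posterior expected loss is nowhere smaller: the two agree almost surely. *)
Lemma bayes_rule_ae_expected_score (delta : X -> Lambda) :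
    bayes_rule M Pi S pi delta ->
  {ae prior_predictive M (prior pi), forall x,
     expected_score S (Pi pi x) (Pi (delta x) x) =
     expected_score S (Pi pi x) (Pi pi x)}.
Proof.
move=> [/bayes_risk_posterior[intd ->]]; rewrite min_bayes_riskE => eq_risk.
have [intpi _] := bayes_risk_posterior decision_rule_cst.
have le x : - expected_score S (Pi pi x) (Pi pi x) <=
    - expected_score S (Pi pi x) (Pi (delta x) x).
  by rewrite leeN2; exact: (hS _ _).2.
have := integral_le_eq_ae intd intpi le eq_risk.
by apply: filterS => x /(_ I) /oppe_inj.
Qed.

End game.

Theorem proposition3p2 (R : realType)
    (T : ptopologicalType) (hT : polish R T)
    (d : measure_display) (X : measurableType d)
    (M : dominated_model R (borel T) X)
    (Lambda : set (weak_probability R T))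
    (Pi : Lambda -> X -> probability (borel T) R)
    (hPi : forall a : Lambda, posterior M (prior a) (Pi a))
    (hid : prior_identifiable M Pi)
    (pi : Lambda)
    (S : probability (borel T) R -> borel T -> \bar R)
    (hS : strictly_proper S)
    (hfin : finite_risks M Pi S pi) :
  (forall delta : X -> Lambda, bayes_rule M Pi S pi delta ->
     {ae prior_predictive M (prior pi), forall x,
        prior (delta x) ≡μ prior pi}) /\
  min_bayes_risk M Pi S pi =
    \int[prior_predictive M (prior pi)]_x entropy S (Pi pi x).
Proof.
have [_ proper_S strict_S] := hS.
split; last exact: min_bayes_riskE.
move=> delta /(bayes_rule_ae_expected_score hPi proper_S hfin).
have := hid pi; apply: filterS2 => x inj_x eq_score.
exact/inj_x/strict_S.
Qed.
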